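(* Let $G$ be a precompact torsion abelian group. The following conditions are equivalent: (1) $G$ has a countably infinite Hausdorff quotient; (2) $G$ has a countably infinite Hausdorff continuous homomorphic image; (3) $G_p^\wedge$ contains an infinite metrizable subgroup; (4) $G_p^\wedge$ contains a nontrivial convergent sequence.
   Context: A topological group is precompact if it is topologically isomorphic to a dense subgroup of a compact (Hausdorff) topological group. A Hausdorff quotient of $G$ is a quotient group $G/N$, with the quotient topology, where $N$ is a closed subgroup of $G$. A Hausdorff continuous homomorphic image of $G$ is a Hausdorff topological group $H$ for which there is a continuous surjective homomorphism $G\to H$. $\mathbb{T}$ is the circle group $\{z\in\mathbb{C}:|z|=1\}$ with its usual compact topology. $G_p^\wedge$ denotes the group of all continuous homomorphisms $G\to\mathbb{T}$ under pointwise multiplication, endowed with the topology of pointwise convergence on elements of $G$. A convergent sequence is nontrivial if it is not eventually constant. *)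

(* Defs.v *)
From HB Require Import structures.
From mathcomp Require Import all_boot all_order all_algebra.
From mathcomp Require Import all_classical all_reals all_analysis.
From mathcomp Require Import complex.

Set Implicit Arguments.
Unset Strict Implicit.
Unset Printing Implicit Defensive.

Import GRing.Theory Num.Theory.
Import numFieldNormedType.Exports.

Local Open Scope classical_set_scope.
Local Open Scope quotient_scope.
Local Open Scope group_scope.

HB.structure Definition PreTopologicalGroup := {G of Topological G & Group G}.

(* As usual for topological groups, no separation axiom is included. *)
HB.mixin Record PreTopologicalGroup_isTopologicalGroup G
    of PreTopologicalGroup G := {
  mulg_continuous : continuous (fun xy : G * G => xy.1 * xy.2 : G) ;
  invg_continuous : continuous (fun x : G => x^-1)
}.

#[short(type="topologicalGroupType")]
HB.structure Definition TopologicalGroup :=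
  {G of PreTopologicalGroup G & PreTopologicalGroup_isTopologicalGroup G}.

Definition abelian_group (G : groupType) : Prop :=
  forall x y : G, x * y = y * x.

Definition torsion_group (G : groupType) : Prop :=
  forall x : G, exists2 n : nat, (0 < n)%N & x ^+ n = 1.

Definition homomorphism (G H : groupType) (f : G -> H) : Prop :=
  {morph f : x y / x * y}.

Definition subgroup (G : groupType) (A : set G) : Prop :=
  [/\ A 1, forall x y, A x -> A y -> A (x * y) & forall x, A x -> A x^-1].

Definition countably_infinite (T : Type) : Prop := ([set: T] #= [set: nat])%card.

(* A topological isomorphism from G onto the subgroup [range f] of K with its
   subspace topology. *)
Definition topological_group_embedding (G K : topologicalGroupType)
    (f : G -> K) : Prop :=
  [/\ homomorphism f, injective f, continuous f &
      forall U, open U -> exists2 V, open V & f @` U = range f `&` V].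

Definition precompact_group (G : topologicalGroupType) : Prop :=
  exists (K : topologicalGroupType) (f : G -> K),
    [/\ compact [set: K], hausdorff_space K,
        topological_group_embedding f & dense (range f)].

Section continuity.
Variable G : topologicalGroupType.

Lemma mulg_cvg (T : Type) (F : set_system T) {FF : Filter F} (f g : T -> G)
  (a b : G) : f @ F --> a -> g @ F --> b -> (fun t => f t * g t) @ F --> a * b.
Proof.
move=> fa gb.
exact: cvg_comp (cvg_pair fa gb) (@mulg_continuous G (a, b)).
Qed.

Lemma mulg_continuousl (a : G) : continuous (fun x : G => a * x).
Proof. by move=> x; apply: mulg_cvg; [exact: cvg_cst|exact: cvg_id]. Qed.

Lemma mulg_continuousr (a : G) : continuous (fun x : G => x * a).
Proof. by move=> x; apply: mulg_cvg; [exact: cvg_id|exact: cvg_cst]. Qed.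

End continuity.

Record normal_subgroup (G : groupType) := NormalSubgroup {
  normal_subgroup_set :> set G ;
  normal_subgroupP : subgroup normal_subgroup_set ;
  normal_subgroupJ :
    forall x y, normal_subgroup_set x -> normal_subgroup_set (y^-1 * x * y)
}.

Section quotient.
Variables (G : topologicalGroupType) (N : normal_subgroup G).

Definition coset_rel : rel G := fun x y => (x^-1 * y \in (N : set G)).

Lemma coset_relP x y : reflect ((N : set G) (x^-1 * y)) (coset_rel x y).
Proof. by apply: (iffP idP); rewrite inE. Qed.

Lemma coset_rel_equiv : equiv_class_of coset_rel.
Proof.
have [N1 NM NV] := normal_subgroupP N.
split=> [x|x y|y x z].
- by apply/coset_relP; rewrite mulVg.
- by apply/coset_relP/coset_relP => /NV; rewrite invgM invgK.
- move=> /coset_relP xy /coset_relP yz; apply/coset_relP.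
  by have := NM _ _ xy yz; rewrite -mulgA mulVKg.
Qed.

Canonical coset_equiv := EquivRelPack coset_rel_equiv.

Definition quotient_group : Type :=
  quotient_topology {eq_quot coset_equiv}.

HB.instance Definition _ := Topological.on quotient_group.

Definition quotient_proj (x : G) : quotient_group :=
  \pi_(quotient_topology {eq_quot coset_equiv}) x.

Definition quotient_repr (q : quotient_group) : G :=
  repr (q : quotient_topology {eq_quot coset_equiv}).

Lemma quotient_reprK : cancel quotient_repr quotient_proj.
Proof. exact: reprK. Qed.

Lemma quotient_projP (x y : G) :
  quotient_proj x = quotient_proj y <-> (N : set G) (x^-1 * y).
Proof.
split=> [/eqquotP/coset_relP//|Nxy].
by apply/eqquotP/coset_relP.
Qed.

Lemma quotient_projE (x y : G) :
  (N : set G) (x^-1 * y) -> quotient_proj x = quotient_proj y.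
Proof. by move/quotient_projP. Qed.

Definition quotient_one : quotient_group := quotient_proj 1.
Definition quotient_inv (q : quotient_group) : quotient_group :=
  quotient_proj (quotient_repr q)^-1.
Definition quotient_mul (q r : quotient_group) : quotient_group :=
  quotient_proj (quotient_repr q * quotient_repr r).

Lemma quotient_mulE (x y : G) :
  quotient_mul (quotient_proj x) (quotient_proj y) = quotient_proj (x * y).
Proof.
have [_ NM _] := normal_subgroupP N.
rewrite /quotient_mul; apply: quotient_projE.
set x' := quotient_repr _; set y' := quotient_repr _.
have xN : (N : set G) (x'^-1 * x) by apply/quotient_projP; exact: quotient_reprK.
have yN : (N : set G) (y'^-1 * y) by apply/quotient_projP; exact: quotient_reprK.
have -> : (x' * y')^-1 * (x * y) = (y'^-1 * (x'^-1 * x) * y') * (y'^-1 * y).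
  by rewrite invgM !mulgA mulgK.
by apply: NM => //; exact: normal_subgroupJ.
Qed.

Lemma quotient_invE (x : G) :
  quotient_inv (quotient_proj x) = quotient_proj x^-1.
Proof.
have [_ _ NV] := normal_subgroupP N.
rewrite /quotient_inv; apply: quotient_projE.
set x' := quotient_repr _.
have xN : (N : set G) (x'^-1 * x) by apply/quotient_projP; exact: quotient_reprK.
have -> : x'^-1^-1 * x^-1 = (x'^-1)^-1 * (x'^-1 * x)^-1 * x'^-1.
  by rewrite invgM !invgK !mulgA mulgK.
by apply: normal_subgroupJ; exact: NV.
Qed.

Lemma quotient_mulA : associative quotient_mul.
Proof.
move=> q r s; rewrite -(quotient_reprK q) -(quotient_reprK r).
by rewrite -(quotient_reprK s) !quotient_mulE mulgA.
Qed.

Lemma quotient_mul1 : left_id quotient_one quotient_mul.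
Proof. by move=> q; rewrite -(quotient_reprK q) quotient_mulE mul1g. Qed.

Lemma quotient_mulr1 : right_id quotient_one quotient_mul.
Proof. by move=> q; rewrite -(quotient_reprK q) quotient_mulE mulg1. Qed.

Lemma quotient_mulV : left_inverse quotient_one quotient_inv quotient_mul.
Proof.
by move=> q; rewrite -(quotient_reprK q) quotient_invE quotient_mulE mulVg.
Qed.

Lemma quotient_mulrV : right_inverse quotient_one quotient_inv quotient_mul.
Proof.
by move=> q; rewrite -(quotient_reprK q) quotient_invE quotient_mulE mulgV.
Qed.

HB.instance Definition _ := isGroup.Build quotient_group
  quotient_mulA quotient_mul1 quotient_mulr1 quotient_mulV quotient_mulrV.

Lemma quotient_projM : homomorphism quotient_proj.
Proof. by move=> x y; rewrite -quotient_mulE. Qed.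

Lemma quotient_proj_continuous : continuous quotient_proj.
Proof. exact: pi_continuous. Qed.

Lemma quotient_proj_open (U : set G) : open U -> open (quotient_proj @` U).
Proof.
move=> oU; rewrite /open/= /quotient_open.
have [N1 _ NV] := normal_subgroupP N.
have -> : \pi_(quotient_topology {eq_quot coset_equiv}) @^-1`
    (quotient_proj @` U) = \bigcup_(n in N) ((fun x => x * n) @^-1` U).
  apply/seteqP; split=> x /=.
    move=> [u Uu /quotient_projP Nux]; exists (u^-1 * x)^-1; first exact: NV.
    by rewrite /= invgM invgK mulgA mulgV mul1g.
  move=> [n Nn /= Uxn]; exists (x * n) => //; apply/quotient_projP.
  by rewrite invgM mulgVK; exact: NV.
apply: bigcup_open => n _; apply: open_comp => // x _.
exact: mulg_continuousr.
Qed.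

Lemma quotient_mul_continuous :
  continuous (fun qr : quotient_group * quotient_group => qr.1 * qr.2).
Proof.
move=> [q r] W /=; rewrite -(quotient_reprK q) -(quotient_reprK r).
set x := quotient_repr q; set y := quotient_repr r.
rewrite -quotient_projM => /quotient_proj_continuous/(@mulg_continuous G (x, y)).
move=> [[A B] /= [/nbhs_interior Ax /nbhs_interior By] AB].
exists (quotient_proj @` A°, quotient_proj @` B°) => /=.
  split; apply: open_nbhs_nbhs; split.
  - by apply: quotient_proj_open; exact: open_interior.
  - by exists x => //; exact: nbhs_singleton.
  - by apply: quotient_proj_open; exact: open_interior.
  - by exists y => //; exact: nbhs_singleton.
move=> [_ _] /= [[a Aa <-] [b Bb <-]]; rewrite -quotient_projM.
by apply: (AB (a, b)); split; exact: interior_subset.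
Qed.

Lemma quotient_inv_continuous : continuous (fun q : quotient_group => q^-1).
Proof.
move=> q; apply: (iffRL (@quotient_continuous _ _ _ (fun q : quotient_group => q^-1))).
have -> : (fun q : quotient_group => q^-1) \o
    \pi_(quotient_topology {eq_quot coset_equiv}) = quotient_proj \o (fun x : G => x^-1).
  by apply/funext => x; exact: quotient_invE.
move=> x; apply: continuous_comp; first exact: invg_continuous.
exact: quotient_proj_continuous.
Qed.

HB.instance Definition _ := PreTopologicalGroup_isTopologicalGroup.Build
  quotient_group quotient_mul_continuous quotient_inv_continuous.

End quotient.

Section circle.
Variable R : realType.
Local Open Scope ring_scope.
Local Open Scope complex_scope.

(* [R[i]^o] carries the topology of the norm. *)
Definition circle_set : set (R[i]^o)%type := [set z | `|z| = 1].

Definition circle : Type := set_type circle_set.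

HB.instance Definition _ := Topological.on circle.

Definition circle_val (z : circle) : (R[i]^o)%type := set_val z.

Lemma circle_valP (z : circle) : `|circle_val z| = 1.
Proof. by have := set_valP z. Qed.

Lemma circle_val_inj : injective circle_val.
Proof. exact: val_inj. Qed.

Definition to_circle (z : R[i]) (z1 : `|z| = 1) : circle :=
  exist _ (z : (R[i]^o)%type) (mem_set z1).

Lemma circle_mul_subproof (z w : circle) : `|circle_val z * circle_val w| = 1.
Proof. by rewrite normrM !circle_valP mulr1. Qed.

Lemma circle_inv_subproof (z : circle) : `|(circle_val z)^-1| = 1.
Proof. by rewrite normrV ?circle_valP ?invr1// unitfE -normr_eq0 circle_valP oner_eq0. Qed.

Definition circle_one : circle := to_circle (normr1 R[i]).
Definition circle_mul (z w : circle) : circle :=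
  to_circle (circle_mul_subproof z w).
Definition circle_inv (z : circle) : circle :=
  to_circle (circle_inv_subproof z).

Lemma circle_mulA : associative circle_mul.
Proof. by move=> x y z; apply: circle_val_inj; exact: mulrA. Qed.

Lemma circle_mulC : commutative circle_mul.
Proof. by move=> x y; apply: circle_val_inj; exact: mulrC. Qed.

Lemma circle_mul1 : left_id circle_one circle_mul.
Proof. by move=> x; apply: circle_val_inj; exact: mul1r. Qed.

Lemma circle_mulr1 : right_id circle_one circle_mul.
Proof. by move=> x; apply: circle_val_inj; exact: mulr1. Qed.

Lemma circle_mulV : left_inverse circle_one circle_inv circle_mul.
Proof.
move=> x; apply: circle_val_inj; apply: mulVf.
by rewrite -normr_eq0 circle_valP oner_eq0.
Qed.

Lemma circle_mulrV : right_inverse circle_one circle_inv circle_mul.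
Proof. by move=> x; rewrite circle_mulC circle_mulV. Qed.

HB.instance Definition _ := isGroup.Build circle
  circle_mulA circle_mul1 circle_mulr1 circle_mulV circle_mulrV.

Lemma circle_val_continuous : continuous circle_val.
Proof. exact: initial_continuous. Qed.

Lemma circle_continuous (T : topologicalType) (f : T -> circle) :
  continuous (circle_val \o f) -> continuous f.
Proof. exact: continuous_comp_initial. Qed.

Lemma circle_mul_continuous :
  continuous (fun zw : circle * circle => (zw.1 * zw.2)%g).
Proof.
apply: circle_continuous => -[z w]; apply: cvgM.
  by apply: cvg_comp; [exact: cvg_fst|exact: circle_val_continuous].
by apply: cvg_comp; [exact: cvg_snd|exact: circle_val_continuous].
Qed.

Lemma circle_inv_continuous : continuous (fun z : circle => (z^-1)%g).
Proof.
apply: circle_continuous => z.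
apply: cvgV; [exact: nbhs_filter| |exact: circle_val_continuous].
by rewrite -normr_eq0 circle_valP oner_eq0.
Qed.

HB.instance Definition _ := PreTopologicalGroup_isTopologicalGroup.Build
  circle circle_mul_continuous circle_inv_continuous.

End circle.

Section dual.
Variables (R : realType) (G : topologicalGroupType).

Definition characters : set {ptws G -> circle R} :=
  [set chi | continuous (chi : G -> circle R) /\
             homomorphism (chi : G -> circle R)].

Definition dual : Type := set_type characters.

HB.instance Definition _ := Topological.on dual.

Definition dual_val (chi : dual) : G -> circle R := set_val chi.

Lemma dual_valP (chi : dual) :
  continuous (dual_val chi) /\ homomorphism (dual_val chi).
Proof. by have := set_valP chi. Qed.

Lemma dual_val_inj : injective dual_val.
Proof. exact: val_inj. Qed.

Definition to_dual (chi : G -> circle R) (cchi : continuous chi)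
    (hchi : homomorphism chi) : dual :=
  exist _ (chi : {ptws G -> circle R}) (mem_set (conj cchi hchi)).

Lemma circle_mulgC : abelian_group (circle R).
Proof. exact: circle_mulC. Qed.

Lemma dual_one_continuous : continuous (fun _ : G => 1 : circle R).
Proof. exact: cst_continuous. Qed.

Lemma dual_one_hom : homomorphism (fun _ : G => 1 : circle R).
Proof. by move=> x y; rewrite mulg1. Qed.

Lemma dual_mul_continuous (chi psi : dual) :
  continuous (fun x => dual_val chi x * dual_val psi x).
Proof.
move=> x; have [cchi _] := dual_valP chi; have [cpsi _] := dual_valP psi.
by apply: mulg_cvg; [exact: cchi|exact: cpsi].
Qed.

Lemma dual_mul_hom (chi psi : dual) :
  homomorphism (fun x => dual_val chi x * dual_val psi x).
Proof.
move=> x y; have [_ hchi] := dual_valP chi; have [_ hpsi] := dual_valP psi.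
rewrite hchi hpsi !mulgA; congr (_ * _); rewrite -!mulgA; congr (_ * _).
exact: circle_mulgC.
Qed.

Lemma dual_inv_continuous (chi : dual) :
  continuous (fun x => (dual_val chi x)^-1).
Proof.
move=> x; have [cchi _] := dual_valP chi.
by apply: (continuous_comp (cchi x)); exact: invg_continuous.
Qed.

Lemma dual_inv_hom (chi : dual) : homomorphism (fun x => (dual_val chi x)^-1).
Proof.
move=> x y; have [_ hchi] := dual_valP chi.
by rewrite hchi invgM; exact: circle_mulgC.
Qed.

Definition dual_one : dual := to_dual dual_one_continuous dual_one_hom.
Definition dual_mul (chi psi : dual) : dual :=
  to_dual (dual_mul_continuous (psi := psi)) (dual_mul_hom chi psi).
Definition dual_inv (chi : dual) : dual :=
  to_dual (dual_inv_continuous (chi := chi)) (dual_inv_hom chi).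

Lemma dual_mulA : associative dual_mul.
Proof.
by move=> a b c; apply: dual_val_inj; apply/funext => x; exact: mulgA.
Qed.

Lemma dual_mul1 : left_id dual_one dual_mul.
Proof. by move=> a; apply: dual_val_inj; apply/funext => x; exact: mul1g. Qed.

Lemma dual_mulr1 : right_id dual_one dual_mul.
Proof. by move=> a; apply: dual_val_inj; apply/funext => x; exact: mulg1. Qed.

Lemma dual_mulV : left_inverse dual_one dual_inv dual_mul.
Proof. by move=> a; apply: dual_val_inj; apply/funext => x; exact: mulVg. Qed.

Lemma dual_mulrV : right_inverse dual_one dual_inv dual_mul.
Proof. by move=> a; apply: dual_val_inj; apply/funext => x; exact: mulgV. Qed.

HB.instance Definition _ := isGroup.Build dual
  dual_mulA dual_mul1 dual_mulr1 dual_mulV dual_mulrV.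

Lemma dual_eval_continuous (x : G) :
  continuous (fun chi : dual => dual_val chi x).
Proof.
move=> chi; apply: (@continuous_comp _ _ _ (set_val : dual -> {ptws G -> circle R})
  (fun f : {ptws G -> circle R} => f x)); first exact: initial_continuous.
exact: (@proj_continuous G (fun=> circle R) x).
Qed.

Lemma dual_cvgP (F : set_system dual) {FF : Filter F} (chi : dual) :
  F --> chi <->
  forall x, (fun psi : dual => dual_val psi x) @ F --> dual_val chi x.
Proof.
split=> [Fchi x|Fchi].
  exact: cvg_comp Fchi (@dual_eval_continuous x chi).
have Fval : set_val @ F --> (set_val chi : {ptws G -> circle R}).
  apply/cvg_sup => x U [/= V [[W oW <-] /= Wx WU]].
  have FW := Fchi x W (open_nbhs_nbhs (conj oW Wx)).
  by apply: (@filterS _ F FF _ _ _ FW) => psi Wpsi; exact: WU.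
move=> U [/= V [[W oW <-] /= Wchi WU]].
have FW := Fval W (open_nbhs_nbhs (conj oW Wchi)).
by apply: (@filterS _ F FF _ _ _ FW) => psi Wpsi; exact: WU.
Qed.

Lemma dual_group_mul_continuous :
  continuous (fun ab : dual * dual => ab.1 * ab.2).
Proof.
move=> [a b]; apply/dual_cvgP => x.
have ca : (fun ab : dual * dual => dual_val ab.1 x) @ nbhs (a, b) -->
    dual_val a x.
  exact: (cvg_comp (fun ab : dual * dual => ab.1)
    (fun psi : dual => dual_val psi x) cvg_fst (@dual_eval_continuous x a)).
have cb : (fun ab : dual * dual => dual_val ab.2 x) @ nbhs (a, b) -->
    dual_val b x.
  exact: (cvg_comp (fun ab : dual * dual => ab.2)
    (fun psi : dual => dual_val psi x) cvg_snd (@dual_eval_continuous x b)).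
exact: (mulg_cvg ca cb).
Qed.

Lemma dual_group_inv_continuous : continuous (fun a : dual => a^-1).
Proof.
move=> a; apply: (iffRL (@dual_cvgP _ (fmap_filter _ (nbhs_filter a)) _)) => x.
exact: cvg_comp (@dual_eval_continuous x a) (@invg_continuous (circle R) _).
Qed.

HB.instance Definition _ := PreTopologicalGroup_isTopologicalGroup.Build
  dual dual_group_mul_continuous dual_group_inv_continuous.

End dual.

Definition metrizable (R : realType) (T : topologicalType) : Prop :=
  exists (M : metricType R) (f : T -> M) (g : M -> T),
    [/\ cancel f g, cancel g f, continuous f & continuous g].

Definition eventually_constant (T : Type) (u : nat -> T) : Prop :=
  exists c : T, \forall n \near \oo, u n = c.

Definition nontrivial_convergent_sequence (T : topologicalType)
    (u : nat -> T) : Prop :=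
  (exists l : T, u @ \oo --> l) /\ ~ eventually_constant u.

(* Main.v *)
Require Import Defs.
From HB Require Import structures.
From mathcomp Require Import all_boot all_order all_algebra.
From mathcomp Require Import all_classical all_reals all_analysis.
From mathcomp Require Import complex separable cyclic cyclotomic ring lra.

(** A character of a torsion group takes at a point x only the finitely many
    values that are roots of unity of order the order of x. So, in the pointwise
    topology, a sequence of characters converging to the trivial one is, at each
    point, eventually equal to 1. Most of the theorem is this remark.

    From a convergent sequence to a quotient: translating the sequence, let
    chi_n tend to 1 without being eventually constant, and let N be the intersection of the kernels of the
    chi_n. The coset of x modulo N is encoded by the finite list of the values
    chi_n x up to the index after which they are all 1; these values are torsion
    points of the circle, hence G/N is countable. If it were finite, finitely
    many representatives would force chi_n = 1 for all large n.

    From a metrizable subgroup to a convergent sequence: the trivial character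
    is not isolated in an infinite subgroup A.
    Indeed a neighbourhood of it contains all characters equal to 1 on a certain
    finite set of points; the values on that set of the elements of A range over
    a finite set, so two distinct elements of A agree there and their quotient
    lies in the neighbourhood. In a metrizable A this produces a sequence of
    nontrivial characters tending to 1.

    From a countable image H to a metrizable subgroup: let N be the kernel of
    G -> H and A the group of the characters trivial on N. Such a character is known from its values on representatives
    of the countably many cosets, so A is metrizable. A finite A would consist
    of characters of finite order, which have only finitely many values jointly;
    but A separates the infinitely many cosets
    (characters_separate_closed_subgroup).

    The separation is the deep point. It is obtained without Haar measure or the
    Peter-Weyl theorem, from Fourier analysis on finite abelian groups. Replace
    G -> H by a homomorphism phi from G into the compact group Q which is the
    quotient of a compact group containing G by the closure of N, and let
    phi x0 <> 1. Take a continuous real function k on Q telling phi x0 from 1,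
    and a neighbourhood V of 1 with k (v^-1 w) - k (phi x0 v^-1 w) >= 1/3 on V;
    N0 translates of V cover Q. A finite part of G is covered by a finite abelian
    group P (finite_cover), on which a fraction at least 1/N0 of the points falls
    in a single translate of V. Summing the inequality over pairs of such points
    and expanding k in characters of P, as in Bogolyubov's lemma, gives a
    character e of P whose coefficient c satisfies |c| |1 - e x0| >= 1/(6 N0)
    (large_fourier_coefficient). As |c| |1 - e x| <= sup |k q - k (phi x q)|, a
    coefficient bounded below makes e continuous with a modulus depending only
    on k and N0. All bounds are uniform in P, so a limit of such characters,
    which exists by Tychonoff's theorem, is a continuous character of G that is
    trivial where phi is and is different from 1 at x0 (enough_characters). *)

Set Implicit Arguments.
Unset Strict Implicit.
Unset Printing Implicit Defensive.

Import Order.TTheory GRing.Theory Num.Theory.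
Import numFieldNormedType.Exports.

Local Open Scope classical_set_scope.

(** * Fourier analysis on finite abelian groups *)

HB.instance Definition _ (P P' : finZmodType) := GRing.Zmodule.on (P * P')%type.

Section finite_fourier.
Local Open Scope ring_scope.
Variable C : numClosedFieldType.

(** The family is indexed by an arbitrary finite type, not by the characters
    themselves, so that bases of products are indexed by products. The
    last condition is the orthogonality relation; it implies that every
    character occurs exactly once. *)
Definition character_basis (P : finZmodType) (B : finType) (e : B -> P -> C) :
    Prop :=
  [/\ forall b x y, e b (x + y) = e b x * e b y,
      forall b x, `|e b x| = 1 &
      forall x, \sum_b e b x = if x == 0 then #|P|%:R else 0].

Section basis.
Variables (P : finZmodType) (B : finType) (e : B -> P -> C).
Hypothesis basis_e : character_basis e.

Let eD b x y : e b (x + y) = e b x * e b y.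
Proof. by have [+ _ _] := basis_e; apply. Qed.

Let e_norm b x : `|e b x| = 1.
Proof. by have [_ + _] := basis_e; apply. Qed.

Let e_sum x : \sum_b e b x = if x == 0 then #|P|%:R else 0.
Proof. by have [_ _ +] := basis_e; apply. Qed.

Let e_neq0 b x : e b x != 0.
Proof. by rewrite -normr_eq0 e_norm oner_eq0. Qed.

Let e0 b : e b 0 = 1.
Proof. by apply: (mulfI (e_neq0 b 0)); rewrite -eD addr0 mulr1. Qed.

Let eN b x : e b (- x) = (e b x)^*.
Proof.
apply: (mulfI (e_neq0 b x)); rewrite -eD subrr e0.
by rewrite -normCK e_norm expr1n.
Qed.

Let P_neq0 : #|P|%:R != 0 :> C.
Proof. by rewrite pnatr_eq0 -lt0n; apply/card_gt0P; exists 0. Qed.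

Definition fourier (k : P -> C) (b : B) : C :=
  (\sum_x k x * (e b x)^*) / #|P|%:R.

Lemma fourier_inversion k x : k x = \sum_b fourier k b * e b x.
Proof.
transitivity (\sum_y k y * (\sum_b e b (x - y)) / #|P|%:R).
  rewrite (bigD1 x)//= subrr e_sum eqxx mulfK// big1 ?addr0// => y yx.
  by rewrite e_sum subr_eq0 eq_sym (negPf yx) mulr0 mul0r.
under eq_bigr do rewrite mulr_sumr mulr_suml.
rewrite exchange_big; apply: eq_bigr => b _.
rewrite /fourier !mulr_suml; apply: eq_bigr => y _.
by rewrite eD eN; ring.
Qed.

Lemma fourier_le1 k b : (forall x, `|k x| <= 1) -> `|fourier k b| <= 1.
Proof.
move=> k1; rewrite /fourier normrM normfV normr_nat ler_pdivrMr; last first.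
  by rewrite lt0r P_neq0 ler0n.
rewrite mul1r (le_trans (ler_norm_sum _ _ _))//.
rewrite -sumr_const; apply: ler_sum => x _.
by rewrite normrM norm_conjC e_norm mulr1.
Qed.

(** A character with a large coefficient in k inherits the modulus of continuity
    of k: translating k by a multiplies its coefficient at b by e b a. *)
Lemma fourier_shift_le k b a eta : 0 <= eta ->
    (forall x, `|k x - k (a + x)| <= eta) ->
  `|fourier k b| * `|1 - e b a| <= eta.
Proof.
move=> eta0 keta.
have -> : `|fourier k b| * `|1 - e b a| =
    `|(\sum_x (k x - k (a + x)) * (e b x)^*) / #|P|%:R|.
  have <- : (fourier k b) * (1 - e b a) =
      (\sum_x (k x - k (a + x)) * (e b x)^*) / #|P|%:R;
    last by rewrite [RHS]normrM.
  under [in RHS]eq_bigr do rewrite mulrBl.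
  rewrite sumrB mulrBl mulrBr mulr1; congr (_ - _).
  rewrite /fourier mulrAC; congr (_ / _).
  rewrite mulr_suml (reindex_inj (addrI a)); apply: eq_bigr => x _ /=.
  rewrite eD rmorphM -!mulrA; congr (_ * _).
  by rewrite mulrCA -normCKC e_norm expr1n mulr1.
rewrite normrM normfV normr_nat ler_pdivrMr; last first.
  by rewrite lt0r P_neq0 ler0n.
rewrite (le_trans (ler_norm_sum _ _ _))//.
rewrite mulr_natr -sumr_const; apply: ler_sum => x _.
by rewrite normrM norm_conjC e_norm mulr1.
Qed.

Variable A : {set P}.

Let S b := \sum_(y in A) e b y.

Let normS b : `|S b| ^+ 2 = \sum_(y in A) \sum_(z in A) e b (y - z).
Proof.
rewrite normCK /S rmorph_sum mulr_suml; apply: eq_bigr => y _.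
by rewrite mulr_sumr; apply: eq_bigr => z _; rewrite eD eN.
Qed.

Lemma parseval_indicator : \sum_b `|S b| ^+ 2 = #|P|%:R * #|A|%:R.
Proof.
under eq_bigr do rewrite normS.
rewrite exchange_big/= mulr_natr -sumr_const; apply: eq_bigr => y yA.
rewrite exchange_big/= (bigD1 y)//= e_sum subrr eqxx big1 ?addr0// => z.
by move=> /andP[_ zy]; rewrite e_sum subr_eq0 eq_sym (negPf zy).
Qed.

(** Summing over differences turns each character into the nonnegative weight
    |S b|^2, whose total mass is known by Parseval's identity. *)
Lemma fourier_difference_sum k a :
  \sum_(y in A) \sum_(z in A) (k (y - z) - k (a + (y - z))) =
  \sum_b fourier k b * (1 - e b a) * `|S b| ^+ 2.
Proof.
under [RHS]eq_bigr do rewrite normS mulr_sumr.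
rewrite [RHS]exchange_big/=; apply: eq_bigr => y _.
under [RHS]eq_bigr do rewrite mulr_sumr.
rewrite [RHS]exchange_big/=; apply: eq_bigr => z _.
rewrite [k (y - z)]fourier_inversion [k (a + _)]fourier_inversion -sumrB.
by apply: eq_bigr => b _; rewrite [e b (a + _)]eD; ring.
Qed.

(** Bogolyubov's argument: the sum of fourier_difference_sum is at least d|A|^2,
    while the weights |S b|^2 add up to |P||A| <= N|A|^2; so some factor in front
    of the weights is at least of the order of d/N. The factor 2 in the bound
    leaves room for a non-strict comparison. *)
Lemma large_fourier_coefficient (k : P -> C) (a : P) (N : nat) (d : C) :
    0 < d -> A != finset.set0 -> (#|P| <= N * #|A|)%N ->
    (forall y z, y \in A -> z \in A -> d <= k (y - z) - k (a + (y - z))) ->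
  exists b, d / (2 * N%:R) <= `|fourier k b| * `|1 - e b a|.
Proof.
move=> d0 A0 PNA kA.
have cA0 : 0 < #|A|%:R :> C by rewrite ltr0n card_gt0.
have N0 : (0 < N)%N.
  move: PNA; case: N => // ; rewrite mul0n leqn0 => /eqP P0.
  by move: P_neq0; rewrite P0 eqxx.
have NC0 : 0 < 2 * N%:R :> C by rewrite mulr_gt0// ltr0n.
apply: contrapT => /forallNP small.
have {}small b : `|fourier k b| * `|1 - e b a| <= d / (2 * N%:R).
  have /negP := small b; rewrite -real_ltNge; first exact: ltW.
    by apply/ger0_real; rewrite mulr_ge0.
  by apply/ger0_real/ltW/divr_gt0.
have lower : d * #|A|%:R * #|A|%:R <=
    \sum_(y in A) \sum_(z in A) (k (y - z) - k (a + (y - z))).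
  rewrite mulr_natr -sumr_const; apply: ler_sum => y yA.
  by rewrite mulr_natr -sumr_const; apply: ler_sum => z zA; exact: kA.
have upper : `|\sum_b fourier k b * (1 - e b a) * `|S b| ^+ 2| <=
    d / (2 * N%:R) * (#|P|%:R * #|A|%:R).
  rewrite -parseval_indicator mulr_sumr (le_trans (ler_norm_sum _ _ _))//.
  apply: ler_sum => b _; rewrite normrM [X in X * _]normrM normrX normr_id.
  by rewrite ler_wpM2r ?exprn_ge0.
have : d * #|A|%:R * #|A|%:R <= d / (2 * N%:R) * (N%:R * #|A|%:R * #|A|%:R).
  rewrite (le_trans lower)// fourier_difference_sum.
  have ge0 : 0 <= \sum_b fourier k b * (1 - e b a) * `|S b| ^+ 2.
    rewrite -fourier_difference_sum (le_trans _ lower)//.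
    by rewrite !mulr_ge0// ltW.
  rewrite -(ger0_norm ge0) (le_trans upper)//.
  apply: ler_wpM2l; first exact/ltW/divr_gt0.
  by rewrite ler_pM2r// -natrM ler_nat.
have -> : d / (2 * N%:R) * (N%:R * #|A|%:R * #|A|%:R) =
    d * #|A|%:R * #|A|%:R / 2.
  have : N%:R != 0 :> C by rewrite pnatr_eq0 -lt0n.
  by move=> ?; field.
rewrite ler_pdivlMr// -[leRHS]mulr1 ler_pM2l ?mulr_gt0//.
by rewrite (ler_nat C 2 1).
Qed.

End basis.

Lemma prod_character_basis (P P' : finZmodType) (B B' : finType)
    (e : B -> P -> C) (e' : B' -> P' -> C) :
    character_basis e -> character_basis e' ->
  character_basis (fun (b : B * B') (x : P * P') => e b.1 x.1 * e' b.2 x.2).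
Proof.
move=> [eD e1 eS] [e'D e'1 e'S]; split=> [b x y|b x|[x x']] /=.
- by rewrite eD e'D mulrACA.
- by rewrite normrM e1 e'1 mulr1.
rewrite -(pair_bigA _ (fun b b' => e b x * e' b' x'))/=.
under eq_bigr do rewrite -mulr_sumr.
rewrite -mulr_suml eS e'S card_prod natrM.
have -> : ((x, x') == 0 :> P * P') = (x == 0) && (x' == 0) by [].
by case: (x == 0); case: (x' == 0); rewrite ?mulr0 ?mul0r.
Qed.

Lemma unity_roots_seq n : (0 < n)%N -> exists r : seq C,
  [/\ uniq r, size r = n & forall z, (z \in r) = (z ^+ n == 1)].
Proof.
move=> n0; have [r Dr] := closed_field_poly_normal ('X^n - 1 : {poly C}).
rewrite (monicP (monicXnsubC 1 n0)) scale1r in Dr.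
exists r; split=> [||z].
- by rewrite -separable_prod_XsubC -Dr separable_Xn_sub_1// pnatr_eq0 -lt0n.
- by have := size_XnsubC (1 : C) n0; rewrite Dr size_prod_XsubC => -[].
- by rewrite -root_prod_XsubC -Dr rootE !hornerE subr_eq0.
Qed.

Lemma primitive_root_exists n : (0 < n)%N -> exists z : C, n.-primitive_root z.
Proof.
move=> n0; have [r [r_uniq r_size rP]] := unity_roots_seq n0.
have r_unity : all n.-unity_root r.
  by apply/allP => z; rewrite rP unity_rootE.
have /hasP[z _ z_prim] : has n.-primitive_root r.
  by apply: has_prim_root; rewrite ?r_size.
by exists z.
Qed.

Lemma cyclic_character_basis n (z : C) : n.+1.-primitive_root z ->
  character_basis (fun b x : 'I_n.+1 => z ^+ (b * x)).
Proof.
move=> z_prim; split=> [b x y|b x|x].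
- rewrite -exprD -mulnDr; apply/eqP; rewrite (eq_prim_root_expr z_prim) /=.
  by rewrite modnMmr.
- apply/eqP; rewrite -(@pexpr_eq1 _ _ n.+1)// -normrX -exprM mulnC exprM.
  by rewrite (prim_expr_order z_prim) expr1n normr1.
- under eq_bigr do rewrite mulnC exprM.
  have [->|x0] := eqVneq x 0.
    by under eq_bigr do rewrite expr1n; rewrite sumr_const.
  apply/eqP; have := subrX1 (z ^+ x) n.+1.
  rewrite -exprM mulnC exprM (prim_expr_order z_prim) expr1n subrr => /esym/eqP.
  rewrite mulf_eq0 => /orP[|//]; rewrite subr_eq0 -(expr0 z).
  rewrite (eq_prim_root_expr z_prim) mod0n modn_small//.
  move=> /eqP/(@ord_inj _ x 0)x00.
  by rewrite x00 eqxx in x0.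
Qed.

End finite_fourier.

Section finite_covers.
Local Open Scope group_scope.
Variables (C : numClosedFieldType) (G : groupType).
Hypothesis G_abelian : abelian_group G.
Hypothesis G_torsion : torsion_group G.

(** A finite subset of a torsion abelian group lies in the image of a product of
    finite cyclic groups, one for each of its elements. Working on that product
    rather than on the generated subgroup makes the characters explicit; those
    of interest will turn out to factor through psi. *)
Lemma finite_cover (s : seq G) :
  exists (P : finZmodType) (B : finType) (e : B -> P -> C) (psi : P -> G),
    [/\ character_basis e, {morph psi : x y / (x + y)%R >-> x * y} &
        forall x, x \in s -> exists a, psi a = x].
Proof.
elim: s => [|x s [P [B [e [psi [basis_e psiD psis]]]]]].
  (* The trivial group is the cyclic group of order 1. *)
  have [z z_prim] := @primitive_root_exists C 1 isT.
  exists 'I_1, 'I_1, (fun b x : 'I_1 => (z ^+ (b * x)%N)%R), (fun=> 1).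
  split => //.
    exact: cyclic_character_basis z_prim.
  by move=> x y; rewrite mulg1.
have [[//|n] _ xn1] := G_torsion x.
have [z z_prim] := @primitive_root_exists C n.+1 isT.
exists (P * 'I_n.+1)%type, (B * 'I_n.+1)%type,
  (fun (b : B * 'I_n.+1) (y : P * 'I_n.+1) =>
    (e b.1 y.1 * z ^+ (b.2 * y.2)%N)%R),
  (fun a : P * 'I_n.+1 => psi a.1 * x ^+ a.2); split.
- exact: prod_character_basis basis_e (cyclic_character_basis z_prim).
- move=> [a i] [b j] /=; rewrite psiD.
  have -> : x ^+ ((i + j) %% n.+1)%N = x ^+ i * x ^+ j.
    rewrite -expgnDr [in RHS](divn_eq (i + j) n.+1) expgnDr mulnC expgnA xn1.
    by rewrite expg1n mul1g.
  rewrite -!mulgA; congr (_ * _); rewrite !mulgA; congr (_ * _).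
  exact: G_abelian.
- have psi0 : psi 0%R = 1.
    by apply: (@mulgI _ (psi 0%R)); rewrite -psiD addr0 mulg1.
  move=> y; rewrite inE => /orP[/eqP ->|/psis[a <-]].
    exists (0%R, inZp 1); rewrite /= psi0 mul1g.
    (* In the cyclic group of order 1 the generator inZp 1 is 0. *)
    case: n xn1 {z z_prim} => [|n] xn1; last by rewrite modn_small.
    by rewrite modn1 expg0; exact: esym xn1.
  by exists (a, 0%R); rewrite /= mulg1.
Qed.

End finite_covers.

(** * Homomorphisms and the circle *)

Section homomorphisms.
Local Open Scope group_scope.
Variables (G H : groupType) (f : G -> H).
Hypothesis fM : homomorphism f.

Lemma homomorphism1 : f 1 = 1.
Proof. by apply: (mulgI (f 1)); rewrite -fM !mulg1. Qed.

Lemma homomorphismV x : f x^-1 = (f x)^-1.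
Proof. by apply: (mulgI (f x)); rewrite -fM !mulgV homomorphism1. Qed.

Lemma homomorphismX x n : f (x ^+ n) = f x ^+ n.
Proof.
by elim: n => [|n IH]; rewrite ?expg0 ?homomorphism1// !expgS fM IH.
Qed.

End homomorphisms.

Section circle_lemmas.
Local Open Scope group_scope.
Variable R : realType.

Lemma circle_valX (z : circle R) n :
  circle_val (z ^+ n) = (circle_val z ^+ n)%R.
Proof. by elim: n => [//|n IH]; rewrite expgS exprS -IH. Qed.

Lemma circle_hausdorff : hausdorff_space (circle R).
Proof.
move=> z w zw; apply: circle_val_inj; apply: norm_hausdorff => A B Az Bw.
have [v [Av Bv]] := zw _ _ (@circle_val_continuous R z _ Az)
  (@circle_val_continuous R w _ Bw).
by exists (circle_val v).
Qed.

Lemma finite_circle_roots n : (0 < n)%N ->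
  finite_set [set z : circle R | z ^+ n = 1].
Proof.
move=> n0; have [r [_ _ rP]] := unity_roots_seq R[i] n0.
apply: (@sub_finite_set _ _ (@circle_val R @^-1` [set` r])).
  by move=> z /= zn; rewrite rP -circle_valX zn eqxx.
apply: finite_preimage; last exact: finite_seq.
by move=> z w _ _; exact: circle_val_inj.
Qed.

Lemma countable_circle_torsion :
  countable [set z : circle R | exists2 n, (0 < n)%N & z ^+ n = 1].
Proof.
have -> : [set z : circle R | exists2 n, (0 < n)%N & z ^+ n = 1] =
    \bigcup_n [set z : circle R | z ^+ n.+1 = 1].
  apply/seteqP; split=> z; first by move=> [[//|n] _ zn]; exists n.
  by move=> [n _ zn]; exists n.+1.
apply: bigcup_countable => // n _.
by apply: finite_set_countable; exact: finite_circle_roots.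
Qed.

End circle_lemmas.

(** * Approximate characters on finite parts *)

Lemma pigeonhole_fiber (P : finType) (N : nat) (c : P -> 'I_N) :
  (0 < #|P|)%N ->
  exists i, (#|P| <= N * #|finset.finset (fun a => c a == i)|)%N.
Proof.
move=> P0; have [a0 _] := card_gt0P P0.
have N0 : (0 < N)%N by case: (c a0) => m; exact: leq_ltn_trans.
apply: contrapT => /forallNP small.
have sumP : (#|P| = \sum_(i < N) #|finset.finset (fun a => c a == i)|)%N.
  rewrite -sum1_card (partition_big c xpredT)//=; apply: eq_bigr => i _.
  by rewrite sum1dep_card.
have : (N * #|P| <= \sum_(i < N) #|P|.-1)%N.
  rewrite {1}sumP big_distrr; apply: leq_sum => i _ /=.
  rewrite -ltnS prednK// ltnNge; apply/negP; exact: small.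
rewrite sum_nat_const card_ord leq_pmul2l//.
by rewrite -{1}(prednK P0) ltnn.
Qed.

Section approximate_characters.
Local Open Scope group_scope.
Variables (R : realType) (G Q : groupType).
Hypotheses (G_abelian : abelian_group G) (G_torsion : torsion_group G).
Variables (phi : G -> Q) (k : Q -> R) (x0 : G) (N : nat).
Variables (q : 'I_N -> Q) (V : set Q).
Hypothesis phiM : homomorphism phi.
Hypothesis k_le1 : forall y, (`|k y| <= 1)%R.
Hypothesis cover_V : forall y, exists i, V ((q i)^-1 * y).
Hypothesis k_drop : forall v w, V v -> V w ->
  (3^-1 <= k (v^-1 * w)%g - k (phi x0 * (v^-1 * w))%g)%R.

(** What a character found on a finite part of G retains about k, as a condition
    on its value z at x: the second clause is continuity with a modulus
    controlled by k, the third one is nontriviality at x0. The first one confines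
    the values to a finite set, which gives the compactness used below. *)
Definition spectral_condition (x : G) (z : circle R) : Prop :=
  [/\ forall n, x ^+ n = 1 -> z ^+ n = 1,
      forall eta : R, (0 <= eta)%R ->
        (forall y, `|k y - k (phi x * y)%g| <= eta)%R ->
        (`|1 - circle_val z| <= (12 * N%:R * eta)%:C%C)%R &
      x = x0 -> (((6 * N%:R)^-1)%:C%C <= `|1 - circle_val z|)%R].

(** The constants in spectral_condition depend only on the number N of
    translates of V that cover Q, and not on the finite part s: this is what
    allows a passage to the limit over s. *)
Lemma approximate_character (s : seq G) : exists chi : G -> circle R,
  (forall x, spectral_condition x (chi x)) /\
  (forall x y, x \in s -> y \in s -> chi (x * y) = chi x * chi y).
Proof.
have [P [B [e [psi [basis_e psiD psis]]]]] :=
  finite_cover R[i] G_abelian G_torsion (x0 :: s).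
have [a0 a0x] : exists a, psi a = x0 by apply: psis; rewrite mem_head.
have psi0 : psi 0%R = 1.
  by apply: (mulgI (psi 0%R)); rewrite -psiD addr0 mulg1.
have psiN a : psi (- a)%R = (psi a)^-1.
  by apply: (mulgI (psi a)); rewrite -psiD subrr psi0 mulgV.
have [eD e_norm e_sum] := basis_e.
have e0 b : e b 0%R = 1%R.
  have : e b 0%R != 0%R by rewrite -normr_eq0 e_norm oner_eq0.
  by move=> /mulfI; apply; rewrite -eD addr0 mulr1.
have P_gt0 : (0 < #|P|)%N by apply/card_gt0P; exists 0%R.
pose h (a : P) : R[i] := (k (phi (psi a)))%:C%C.
have norm_real (r : R) : `|r%:C%C|%R = `|r|%R%:C%C.
  by rewrite normc_def /= expr0n addr0 sqrtr_sqr.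
have h_le1 a : (`|h a| <= 1)%R by rewrite norm_real lecR.
have [c cP] := choice (fun a => cover_V (phi (psi a))).
have [i Pi] := pigeonhole_fiber c P_gt0.
have N0 : (0 < N)%N by case: (i) => m; exact: leq_ltn_trans.
have NC0 : (0 < N%:R :> R[i])%R by rewrite ltr0n.
pose A := finset.finset (fun a => c a == i).
have A0 : A != finset.set0.
  rewrite -card_gt0; case: #|A| Pi => [|//].
  rewrite muln0 leqn0 => /eqP/card0_eq.
  by move=> /(_ 0%R).
have drop y z : y \in A -> z \in A ->
    (3^-1 <= h (y - z) - h (a0 + (y - z)))%R.
  rewrite !finset.inE => /eqP cy /eqP cz.
  have E : phi (psi (y - z)%R) =
      ((q i)^-1 * phi (psi z))^-1 * ((q i)^-1 * phi (psi y)).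
    rewrite addrC psiD psiN phiM (homomorphismV phiM).
    by rewrite invgM invgK !mulgA mulgK.
  rewrite /h [psi (a0 + _)%R]psiD a0x phiM E -rmorphB.
  have -> : (3^-1 : R[i])%R = (3^-1 : R)%R%:C%C by rewrite fmorphV rmorph_nat.
  by rewrite lecR; apply: k_drop; [rewrite -cz|rewrite -cy]; exact: cP.
have third_gt0 : (0 < 3^-1 :> R[i])%R by rewrite invr_gt0.
have [b] := large_fourier_coefficient basis_e third_gt0 A0 Pi drop.
set f := `|fourier e h b|%R => fb.
have f0 : (0 <= f)%R by exact: normr_ge0.
have f1 : (f <= 1)%R by exact: fourier_le1.
(* |1 - e b a0| <= 2 turns the product bound into a bound on the coefficient. *)
have f_ge : ((12 * N%:R)^-1 <= f)%R.
  have -> : ((12 * N%:R)^-1 = 3^-1 / (2 * N%:R) / 2 :> R[i])%R.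
    by field; rewrite lt0r_neq0.
  rewrite ler_pdivrMr// (le_trans fb)// ler_wpM2l//.
  by rewrite (le_trans (ler_normB _ _))// normr1 e_norm.
have kernel_condition a eta : (0 <= eta)%R ->
    (forall y, `|k y - k (phi (psi a) * y)%g| <= eta)%R ->
    (`|1 - e b a| <= (12 * N%:R * eta)%:C%C)%R.
  move=> eta0 keta.
  have : (f * `|1 - e b a| <= eta%:C%C)%R.
    apply: fourier_shift_le => //; first by rewrite lecR.
    by move=> y; rewrite /h psiD phiM -rmorphB norm_real lecR.
  rewrite !rmorphM/= !rmorph_nat => /(le_trans (ler_wpM2r _ f_ge)).
  by rewrite ler_pdivrMl ?mulr_gt0//; apply.
(* Translation by phi (psi a) = 1 does not move k, so e b factors through psi. *)
have e_ker a : psi a = 1 -> e b a = 1%R.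
  move=> a1; have := @kernel_condition a 0%R (lexx _).
  rewrite a1 (homomorphism1 phiM) mulr0 normr_le0 subr_eq0 => /(_ _)/eqP -> //.
  by move=> y; rewrite mul1g subrr normr0.
have e_inj a a' : psi a = psi a' -> e b a = e b a'.
  move=> aa'; rewrite -[a](subrK a') eD e_ker ?mul1r//.
  by rewrite psiD psiN aa' mulgV.
(* Off the range of psi, the value 1 satisfies the spectral condition: x0 is
   in the range. *)
pose chi x := if [pick a | psi a == x] is Some a then to_circle (e_norm b a)
  else 1.
have chiE a : circle_val (chi (psi a)) = e b a.
  rewrite /chi; case: pickP => [a' /eqP/e_inj //|/(_ a)]; by rewrite eqxx.
exists chi; split=> [x|x y xs ys].
  have [[a ax]|/forallNP nx] := pselect (exists a, psi a = x).
    rewrite -ax; split=> [n an1|eta eta0 keta|ax0].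
    - apply: circle_val_inj; rewrite circle_valX chiE.
      have {an1} : psi (a *+ n)%R = 1.
        by rewrite -an1; elim: n {an1} => [//|n IH];
          rewrite mulrS psiD IH expgS.
      move=> /e_ker en; transitivity (e b (a *+ n)%R); last by rewrite en.
      elim: n {en} => [|n IH]; first by rewrite expr0 e0.
      by rewrite exprS IH mulrS eD.
    - by rewrite chiE; exact: kernel_condition.
    - rewrite chiE (e_inj a a0) ?ax0 ?a0x//.
      rewrite fmorphV rmorphM !rmorph_nat.
      have -> : ((6 * N%:R)^-1 = 3^-1 / (2 * N%:R) :> R[i])%R.
        by field; rewrite lt0r_neq0.
      by rewrite (le_trans fb)// ler_piMl.
  have chix : chi x = 1.
    by rewrite /chi; case: pickP => // a /eqP ax; case: (nx a).
  rewrite chix; split=> [n _|eta eta0 _|xx0].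
  - exact: expg1n.
  - by rewrite subrr normr0 lecR !mulr_ge0.
  - by case: (nx a0); rewrite a0x.
have [a ax] : exists a, psi a = x by apply: psis; rewrite inE xs orbT.
have [a' ay] : exists a, psi a = y by apply: psis; rewrite inE ys orbT.
apply: circle_val_inj; rewrite -ax -ay -psiD chiE.
by rewrite eD -!chiE.
Qed.

End approximate_characters.

(** * Passage to the limit over finite parts *)

Section topological_groups.
Local Open Scope group_scope.

Lemma closed_equalizer (T : topologicalType) (H : topologicalGroupType)
    (f g : T -> H) : hausdorff_space H -> continuous f -> continuous g ->
  closed [set x | f x = g x].
Proof.
move=> hH cf cg.
have -> : [set x | f x = g x] = (fun x => (f x)^-1 * g x) @^-1` [set 1].
  apply/seteqP; split=> x /= => [->|fg]; first by rewrite mulVg.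
  by apply: (mulgI (f x)^-1); rewrite fg mulVg.
apply: preimage_closed; last first.
  by apply: accessible_closed_set1; exact: hausdorff_accessible.
move=> x _; apply: mulg_cvg; last exact: cg.
exact: cvg_comp (cf x) (@invg_continuous H _).
Qed.

Lemma hausdorff_of_closed1 (H : topologicalGroupType) :
  closed [set (1 : H)] -> hausdorff_space H.
Proof.
move=> cl1 p q pq; apply: contrapT => npq.
have near1 : nbhs (p^-1 * q) (~` [set (1 : H)]).
  apply: open_nbhs_nbhs; split; first exact: closed_openC.
  by move=> /= /mulg1_eq; rewrite invgK.
have : (fun zw : H * H => zw.1^-1 * zw.2) @ nbhs (p, q) --> p^-1 * q.
  apply: mulg_cvg; last exact: cvg_snd.
  exact: (cvg_comp (fun zw : H * H => zw.1) (fun z => z^-1) cvg_fst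
    (@invg_continuous H p)).
move=> /(_ _ near1)[[A B] /= [Ap Bq] AB].
have [z [Az Bz]] := pq _ _ Ap Bq.
by apply: (AB (z, z)) => //=; rewrite mulVg.
Qed.

(** Compactness: the maps with values in the K x that are multiplicative on a
    finite part s form nonempty sets, decreasing in s, of the compact product of
    the K x, and a cluster point is multiplicative everywhere. *)
Lemma limit_homomorphism (G : groupType) (H : topologicalGroupType)
    (K : G -> set H) : hausdorff_space H -> (forall x, compact (K x)) ->
    (forall s : seq G, exists chi : G -> H, (forall x, K x (chi x)) /\
      (forall x y, x \in s -> y \in s -> chi (x * y) = chi x * chi y)) ->
  exists2 chi : G -> H, homomorphism chi & forall x, K x (chi x).
Proof.
move=> hH cK loc.
pose local_hom (s : seq G) : set {ptws G -> H} := [set chi |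
  (forall x, K x (chi x)) /\
  (forall x y, x \in s -> y \in s -> chi (x * y) = chi x * chi y)].
have fin_inter : ProperFilter (filter_from [set: seq G] local_hom).
  apply: filter_from_proper; last first.
    by move=> s _; have [chi chis] := loc s; exists chi.
  apply: filter_from_filter; first by exists [::].
  move=> s t _ _; exists (s ++ t) => // chi [Kchi chiM].
  by split; split=> // x y xs ys; apply: chiM; rewrite mem_cat ?xs ?ys ?orbT.
have [chi [Kchi cl_chi]] := tychonoff cK fin_inter
  (ex_intro2 _ _ [::] I (fun chi => @proj1 _ _)).
exists chi => // x y.
have cproj z : continuous (fun f : {ptws G -> H} => f z).
  exact: (@proj_continuous G (fun=> H) z).
have : closed [set f : {ptws G -> H} | f (x * y) = f x * f y].
  apply: (@closed_equalizer {ptws G -> H} H (fun f => f (x * y))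
    (fun f => f x * f y)) => // f.
  exact: (mulg_cvg (cproj x f) (cproj y f)).
apply => U Uchi; apply: cl_chi Uchi; exists [:: x; y] => // f [_].
by apply; rewrite !inE eqxx ?orbT.
Qed.

Lemma compact_group_uniformly_continuous (R : realType)
    (Q : topologicalGroupType) (k : Q -> R) (eta : R) :
    compact [set: Q] -> continuous k -> (0 < eta)%R ->
  \forall x \near (1 : Q), forall y, (`|k y - k (x * y)%g| <= eta)%R.
Proof.
move=> /compact_near_coveringP cQ ck eta0.
have near_y (y : Q) : \forall y' \near y & x \near (1 : Q),
    (`|k y' - k (x * y')%g| <= eta)%R.
  have cvg0 : (fun yx : Q * Q => (k yx.1 - k (yx.2 * yx.1)%g)%R) @ nbhs (y, 1)
      --> (k y - k (1 * y)%g)%R.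
    apply: cvgB.
      exact: (cvg_comp (fun yx : Q * Q => yx.1) k cvg_fst (ck y)).
    have mul_yx : (fun yx : Q * Q => yx.2 * yx.1) @ nbhs (y, 1) --> 1 * y.
      by apply: mulg_cvg; [exact: cvg_snd|exact: cvg_fst].
    exact: cvg_comp mul_yx (ck (1 * y)).
  rewrite mul1g subrr in cvg0.
  exact: (cvgr0_norm_le _ cvg0 eta eta0).
have near1 := cQ Q (nbhs (1 : Q)) (fun x y => (`|k y - k (x * y)%g| <= eta)%R)
  (nbhs_filter _) (fun y _ => near_y y).
by apply: filterS near1 => x kx y; exact: kx.
Qed.

Lemma finite_translate_cover (Q : topologicalGroupType) (V : set Q) :
    compact [set: Q] -> nbhs (1 : Q) V ->
  exists (N : nat) (q : 'I_N -> Q), forall y, exists i, V ((q i)^-1 * y).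
Proof.
move=> /compact_near_coveringP cQ V1.
pose F := filter_from [set: seq Q] (fun s => [set t : seq Q | {subset s <= t}]).
have FF : Filter F.
  apply: filter_from_filter; first by exists [::].
  move=> s t _ _; exists (s ++ t) => // u su.
  by split=> x xs; apply: su; rewrite mem_cat xs ?orbT.
have [s _ sP] : \forall t \near F, [set: Q] `<=`
    [set y : Q | exists2 q : Q, q \in t & V (q^-1 * y)].
  apply: cQ => y _.
  exists ((fun z => y^-1 * z) @^-1` V,
    [set t : seq Q | {subset [:: y] <= t}]) => /=.
    split; last by exists [:: y].
    by apply: mulg_continuousl; rewrite mulVg.
  move=> [z t] [/= Vz yt]; exists y => //.
  by apply: yt; rewrite mem_head.
exists (size s), (fun i => nth 1 s i) => y.
have [q qs Vq] := sP s (fun _ => id) y I.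
have iq : (index q s < size s)%N by rewrite index_mem.
by exists (Ordinal iq); rewrite /= nth_index.
Qed.

Section enough_characters.
Variables (R : realType) (G Q : topologicalGroupType).
Hypotheses (G_abelian : abelian_group G) (G_torsion : torsion_group G).
Hypotheses (compact_Q : compact [set: Q]) (hausdorff_Q : hausdorff_space Q).
Variable phi : G -> Q.
Hypotheses (phiM : homomorphism phi) (phi_cont : continuous phi).

(** The function k separates phi x0 from 1, as Q is completely regular; the
    neighbourhood V is chosen so that k drops by at least 1/3, any constant below
    1, on translation by phi x0. The limit of the approximate characters is
    continuous because k is uniformly continuous on the compact group Q. *)
Lemma enough_characters (x0 : G) : phi x0 <> 1 -> exists chi : dual R G,
  (forall x, phi x = 1 -> dual_val chi x = 1) /\ dual_val chi x0 <> 1.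
Proof.
move=> phix0.
have sep : uniform_separator [set phi x0] [set (1 : Q)].
  apply: (@normal_completely_regular R) => //.
  - exact: compact_normal.
  - exact: hausdorff_accessible.
  - by apply: accessible_closed_set1; exact: hausdorff_accessible.
have [k [ck k01 kx0 k1]] := (@uniform_separatorP Q R _ _).1 sep.
have {}kx0 : k (phi x0) = 0%R by apply: kx0; exists (phi x0).
have {}k1 : k 1 = 1%R by apply: k1; exists 1.
have k_le1 y : (`|k y| <= 1)%R.
  have /= := k01 (k y) (ex_intro2 _ _ y I erefl).
  by rewrite in_itv /= => /andP[k0 ky]; rewrite ger0_norm.
have [V V1 k_drop] : exists2 V, nbhs (1 : Q) V & forall v w, V v -> V w ->
    (3^-1 <= k (v^-1 * w)%g - k (phi x0 * (v^-1 * w))%g)%R.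
  have vw : (fun vw : Q * Q => vw.1^-1 * vw.2) @ nbhs (1, 1) --> (1^-1 * 1 : Q).
    apply: mulg_cvg; last exact: cvg_snd.
    exact: (cvg_comp (fun vw : Q * Q => vw.1) (fun v => v^-1) cvg_fst
      (@invg_continuous Q 1)).
  rewrite invg1 mul1g in vw.
  have drop_cvg : (fun vw : Q * Q => k (vw.1^-1 * vw.2)%g -
      k (phi x0 * (vw.1^-1 * vw.2))%g)%R @ nbhs (1, 1) -->
      (k 1%g - k (phi x0 * 1)%g)%R.
    apply: cvgB; first exact: cvg_comp vw (ck 1).
    exact: cvg_comp (cvg_comp _ _ vw (@mulg_continuousl Q (phi x0) 1)) (ck _).
  rewrite mulg1 k1 kx0 subr0 in drop_cvg.
  have third_lt1 : (3^-1 < 1 :> R)%R by rewrite invf_lt1// ltr1n.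
  have [[A B] /= [A1 B1] AB] := cvgr_ge _ drop_cvg _ third_lt1.
  exists (A `&` B); first exact: filterI.
  by move=> v w [Av _] [_ Bw]; exact: (AB (v, w)).
have [N [q cover_V]] := finite_translate_cover compact_Q V1.
(* Any subset of the finite set of the roots of unity of order n is compact. *)
have finite_condition x : compact (spectral_condition phi k x0 N x).
  apply: finite_compact; have [n n0 xn1] := G_torsion x.
  by apply: sub_finite_set (finite_circle_roots R n0) => z [+ _ _]; exact.
have [chi chiM chiP] := limit_homomorphism (@circle_hausdorff R)
  finite_condition (approximate_character G_abelian G_torsion phiM k_le1
    cover_V k_drop).
have N0 : (0 < N)%N.
  by have [[m mN] _] := cover_V 1; exact: leq_ltn_trans mN.
have N_gt0 : (0 < N%:R :> R)%R by rewrite ltr0n.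
have chi_cont : continuous chi.
  apply: circle_continuous => x; apply/cvgrPdist_le => /= eps eps0.
  have epsE : eps = (complex.Re eps)%:C%C by rewrite RRe_real// gtr0_real.
  have eta0 : (0 < complex.Re eps / (12 * N%:R))%R.
    by rewrite divr_gt0 ?mulr_gt0// -ltcR -epsE.
  have near1 := compact_group_uniformly_continuous compact_Q ck eta0.
  have phi_near : (fun y => phi (x^-1 * y)) @ nbhs x --> (1 : Q).
    rewrite -(homomorphism1 phiM) -[X in phi X](mulVg x).
    exact: (cvg_comp (fun y => x^-1 * y) phi (@mulg_continuousl G x^-1 x)
      (@phi_cont (x^-1 * x))).
  near=> y.
  have [_ /(_ _ (ltW eta0)) chixy _] := chiP (x^-1 * y).
  have -> : (`|circle_val (chi x) - circle_val (chi y)| =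
      `|1 - circle_val (chi (x^-1 * y)%g)|)%R.
    rewrite -[in LHS](mulVKg x y) chiM -[circle_val (_ * _)]/(_ * _)%R.
    by rewrite -[X in (X - _)%R]mulr1 -mulrBr normrM circle_valP mul1r.
  rewrite epsE (le_trans (chixy _))//; last first.
    by rewrite lecR mulrCA divff ?mulr1// lt0r_neq0// mulr_gt0.
  near: y; exact: phi_near near1.
exists (to_dual chi_cont chiM); split=> [x phix1|chix0].
  have [_ /(_ 0%R (lexx _)) chix _] := chiP x; apply: circle_val_inj.
  apply/esym/eqP; rewrite -subr_eq0 -normr_le0.
  rewrite (le_trans (chix _)) ?mulr0// => y.
  by rewrite phix1 mul1g subrr normr0.
have [_ _ /(_ erefl)] := chiP x0.
rewrite [chi x0]chix0 subrr normr0 lecR invr_le0 leNgt.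
by rewrite mulr_gt0.
Unshelve. all: by end_near. Qed.

End enough_characters.

End topological_groups.

(** * Separation of closed subgroups by characters *)

Section separation_by_characters.
Local Open Scope group_scope.

Lemma quotient_hausdorff (G : topologicalGroupType) (N : normal_subgroup G) :
  closed (N : set G) -> hausdorff_space (quotient_group N).
Proof.
move=> cN; apply: hausdorff_of_closed1; rewrite -openC.
have -> : ~` [set (1 : quotient_group N)] = quotient_proj N @` (~` N).
  apply/seteqP; split=> [q /= q1|_ /= [x Nx <-]].
    exists (quotient_repr q); last exact: quotient_reprK.
    move=> Nq; apply: q1; rewrite -[q]quotient_reprK.
    apply/esym/quotient_projP; by rewrite invg1 mul1g.
  by move=> /esym/quotient_projP; rewrite invg1 mul1g.
by apply: quotient_proj_open; exact: closed_openC.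
Qed.

Lemma quotient_compact (G : topologicalGroupType) (N : normal_subgroup G) :
  compact [set: G] -> compact [set: quotient_group N].
Proof.
move=> cG.
have -> : [set: quotient_group N] = quotient_proj N @` setT.
  apply/esym/seteqP; split=> // q _; exists (quotient_repr q) => //.
  exact: quotient_reprK.
apply: continuous_compact => //; apply: continuous_subspaceT.
exact: quotient_proj_continuous.
Qed.

Lemma closure_subgroup (K : topologicalGroupType) (A : set K) :
  subgroup A -> subgroup (closure A).
Proof.
move=> [A1 AM AV]; split=> [|x y Ax Ay U Uxy|x Ax U Ux].
- exact: subset_closure.
- have [[V W] /= [Vx Wy] VW] := @mulg_continuous K (x, y) U Uxy.
  have [[a [Aa Va]] [b [Ab Wb]]] := (Ax V Vx, Ay W Wy).
  by exists (a * b); split; [exact: AM|exact: (VW (a, b))].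
- have [a [Aa Ua]] := Ax _ (@invg_continuous K x U Ux).
  by exists a^-1; split; first exact: AV.
Qed.

(** Commuting with a given element is a closed condition, so commutativity
    spreads from D to K one argument at a time. *)
Lemma abelian_of_dense (K : topologicalGroupType) (D : set K) :
  hausdorff_space K -> dense D -> (forall x y, D x -> D y -> x * y = y * x) ->
  abelian_group K.
Proof.
move=> hK dD Dab.
have dense_closed (C : set K) x : closed C -> D `<=` C -> C x.
  move=> cC DC; apply: contrapT => nCx.
  have [y [nCy Dy]] := dD (~` C) (ex_intro _ x nCx) (closed_openC cC).
  by apply: nCy; exact: DC.
have Dcomm x y : D x -> x * y = y * x.
  move=> Dx; apply: (dense_closed [set z | x * z = z * x]).
    apply: closed_equalizer => //; first exact: mulg_continuousl.
    exact: mulg_continuousr.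
  by move=> z Dz; exact: Dab.
move=> x y; apply: (dense_closed [set z | z * y = y * z]).
  apply: closed_equalizer => //; first exact: mulg_continuousr.
  exact: mulg_continuousl.
by move=> z Dz; exact: Dcomm.
Qed.

(** The closure of N in a compact group K containing G meets G exactly in N, so x
    has a nontrivial image in the compact Hausdorff quotient of K by it. *)
Lemma characters_separate_closed_subgroup (R : realType)
    (G : topologicalGroupType) (N : set G) (x : G) :
    precompact_group G -> torsion_group G -> abelian_group G ->
    subgroup N -> closed N -> ~ N x ->
  exists chi : dual R G,
    (forall y, N y -> dual_val chi y = 1) /\ dual_val chi x <> 1.
Proof.
move=> [K [j [cK hK [jM jI jC jO] dj]]] G_torsion G_abelian [N1 NM NV] cN nNx.
have K_abelian : abelian_group K.
  apply: abelian_of_dense hK dj _ => _ _ [a _ <-] [b _ <-].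
  by rewrite -!jM G_abelian.
have jN_subgroup : subgroup (j @` N).
  split=> [|_ _ [a Na <-] [b Nb <-]|_ [a Na <-]].
  - by exists 1 => //; exact: homomorphism1.
  - by exists (a * b); [exact: NM|exact: jM].
  - by exists a^-1; [exact: NV|exact: homomorphismV].
have jN_normal a b : closure (j @` N) a -> closure (j @` N) (b^-1 * a * b).
  by rewrite -mulgA (K_abelian a) mulKg.
pose M := NormalSubgroup (closure_subgroup jN_subgroup) jN_normal.
have proj1 a : quotient_proj M a = 1 <-> closure (j @` N) a.
  have -> : (1 : quotient_group M) = quotient_proj M 1 by [].
  split=> [/esym/quotient_projP|Ma]; first by rewrite invg1 mul1g.
  by apply/esym/quotient_projP; rewrite invg1 mul1g.
pose phi := quotient_proj M \o j.
have phiM : homomorphism phi.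
  by move=> a b; rewrite /phi /= jM quotient_projM.
have phi_cont : continuous phi.
  move=> a; apply: continuous_comp; first exact: jC.
  exact: quotient_proj_continuous.
have phix : phi x <> 1.
  move=> /proj1 clx; have [V oV VN] := jO _ (closed_openC cN).
  have [_ Vx] : (range j `&` V) (j x) by rewrite -VN; exists x.
  have [_ [[a Na <-] Va]] := clx V (open_nbhs_nbhs (conj oV Vx)).
  have : (j @` (~` N)) (j a) by rewrite VN; split => //; exists a.
  by move=> [b nNb /jI ba]; apply: nNb; rewrite ba.
have [chi [chi1 chix]] := @enough_characters R _ _ G_abelian G_torsion
  (quotient_compact (N := M) cK)
  (quotient_hausdorff (N := M) (@closed_closure _ _)) _ phiM phi_cont _ phix.
exists chi; split=> // y Ny; apply: chi1; apply/proj1.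
by apply: subset_closure; exists y.
Qed.

End separation_by_characters.

(** * Metrizability of countably determined sets of characters *)

Section countable_metrization.
Local Open Scope group_scope.
Variables (R : realType) (G : topologicalGroupType).

Definition circle_dist (z w : circle R) : R :=
  complex.Re `|circle_val z - circle_val w|%R.

Lemma circle_distE z w :
  (`|circle_val z - circle_val w| = (circle_dist z w)%:C%C)%R.
Proof. by rewrite RRe_real// normr_real. Qed.

Lemma circle_dist_ge0 z w : (0 <= circle_dist z w)%R.
Proof. by rewrite -lecR -circle_distE normr_ge0. Qed.

Lemma circle_dist_le2 z w : (circle_dist z w <= 2)%R.
Proof.
rewrite -lecR -circle_distE rmorph_nat.
by rewrite (le_trans (ler_normB _ _))// !circle_valP.
Qed.

Lemma circle_distxx z : circle_dist z z = 0%R.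
Proof. by rewrite /circle_dist subrr normr0. Qed.

Lemma circle_dist_eq0 z w : circle_dist z w = 0%R -> z = w.
Proof.
move=> zw; apply: circle_val_inj; apply/eqP.
by rewrite -subr_eq0 -normr_eq0 circle_distE zw.
Qed.

Lemma circle_distC z w : circle_dist z w = circle_dist w z.
Proof. by rewrite /circle_dist distrC. Qed.

Lemma circle_dist_triangle y x z :
  (circle_dist x z <= circle_dist x y + circle_dist y z)%R.
Proof. by rewrite -lecR rmorphD -!circle_distE ler_distD. Qed.

Lemma circle_dist_near (z : circle R) (eps : R) : (0 < eps)%R ->
  \forall w \near z, (circle_dist z w < eps)%R.
Proof.
move=> eps0; have eps0' : (0 < eps%:C%C)%R by rewrite ltcR.
have /cvgrPdist_lt/(_ _ eps0') near_z := @circle_val_continuous R z.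
by apply: filterS near_z => w; rewrite circle_distE ltcR.
Qed.

Lemma circle_dist_cvg (T : Type) (F : set_system T) (FF : Filter F)
    (f : T -> circle R) (z : circle R) :
    (forall eps, (0 < eps)%R ->
      \forall t \near F, (circle_dist z (f t) < eps)%R) ->
  f @ F --> z.
Proof.
move=> fz.
have : (fun t => circle_val (f t)) @ F --> circle_val z.
  apply/cvgrPdist_lt => eps eps0.
  have epsE : eps = (complex.Re eps)%:C%C by rewrite RRe_real// gtr0_real.
  have /fz : (0 < complex.Re eps)%R by rewrite -ltcR -epsE.
  by apply: filterS => t; rewrite circle_distE [in X in _ -> X]epsE ltcR.
move=> fz' U [/= V [[W oW <-] /= Wz WU]].
have FW := fz' W (open_nbhs_nbhs (conj oW Wz)).
by apply: (@filterS _ F FF _ _ _ FW) => t Wt; exact: WU.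
Qed.

Variables (A : set (dual R G)) (g : nat -> G).
Hypothesis g_dense : forall x, exists n, forall chi, A chi ->
  dual_val chi x = dual_val chi (g n).

(** The argument records the countable set of points that defines the metric; a
    separate copy of A keeps the metric apart from its subspace topology. *)
Definition metric_copy (_ : forall x, exists n, forall chi, A chi ->
  dual_val chi x = dual_val chi (g n)) : Type := set_type A.

Local Notation M := (metric_copy g_dense).

HB.instance Definition _ := Choice.on M.

Implicit Types chi psi : M.

(** Division by n + 1 makes all but finitely many coordinates uniformly small, so
    that the supremum below metrizes pointwise convergence. *)
Definition scaled_dist chi psi (n : nat) : R :=
  (circle_dist (dual_val (set_val chi) (g n)) (dual_val (set_val psi) (g n))
    / n.+1%:R)%R.

Definition character_dist chi psi : R := sup (range (scaled_dist chi psi)).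

Lemma scaled_dist_ge0 chi psi n : (0 <= scaled_dist chi psi n)%R.
Proof. by rewrite divr_ge0// circle_dist_ge0. Qed.

Lemma scaled_dist_le chi psi n : (scaled_dist chi psi n <= 2 / n.+1%:R)%R.
Proof. by rewrite ler_pM2r ?invr_gt0// circle_dist_le2. Qed.

Lemma scaled_dist_ub chi psi n :
  (scaled_dist chi psi n <= character_dist chi psi)%R.
Proof.
apply: ub_le_sup; last by exists n.
exists 2%R => _ [m _ <-]; rewrite (le_trans (scaled_dist_le _ _ _))//.
by rewrite ler_pdivrMr// ler_peMr// ler1n.
Qed.

Lemma character_dist_le chi psi r :
  (forall n, scaled_dist chi psi n <= r)%R -> (character_dist chi psi <= r)%R.
Proof.
move=> le_r; apply: ge_sup; first by exists (scaled_dist chi psi 0); exists 0.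
by move=> _ [n _ <-].
Qed.

Lemma character_distxx chi : character_dist chi chi = 0%R.
Proof.
apply/eqP; rewrite eq_le.
rewrite (le_trans (scaled_dist_ge0 _ _ 0) (scaled_dist_ub _ _ _)).
rewrite andbT; apply: character_dist_le => n.
by rewrite /scaled_dist circle_distxx mul0r.
Qed.

Lemma character_dist_eq0 chi psi : character_dist chi psi = 0%R -> chi = psi.
Proof.
move=> d0; apply: val_inj; apply: dual_val_inj; apply/funext => x.
have [n gn] := g_dense x.
rewrite [LHS]gn; last exact: set_valP.
rewrite [RHS]gn; last exact: set_valP.
apply: circle_dist_eq0; apply/eqP; rewrite eq_le circle_dist_ge0 andbT.
have := scaled_dist_ub chi psi n.
by rewrite d0 /scaled_dist ler_pdivrMr// mul0r.
Qed.

Lemma character_distC chi psi : character_dist chi psi = character_dist psi chi.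
Proof.
rewrite /character_dist.
suff -> : scaled_dist chi psi = scaled_dist psi chi by [].
by apply/funext => n; rewrite /scaled_dist circle_distC.
Qed.

Lemma character_dist_triangle psi chi xi :
  (character_dist chi xi <= character_dist chi psi + character_dist psi xi)%R.
Proof.
apply: character_dist_le => n.
rewrite (le_trans _ (lerD (scaled_dist_ub _ _ n) (scaled_dist_ub _ _ n)))//.
by rewrite -mulrDl ler_pM2r ?invr_gt0// circle_dist_triangle.
Qed.

HB.instance Definition _ := isMetric.Build R M
  character_distxx character_dist_eq0 character_distC character_dist_triangle.

Lemma metrizable_character_set : metrizable R (set_type A).
Proof.
exists M, (id : set_type A -> M), (id : M -> set_type A).
split=> //.
- move=> chi; apply: (iffRL (@cvg_ballP R M (set_type A) _
    (nbhs_filter (chi : set_type A)) id chi)) => eps eps0.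
  have [m m_eps] : exists m, (m.+1%:R^-1 < eps / 4 :> R)%R.
    have [|m] := @ltr_add_invr R 0%R (eps / 4)%R; first by rewrite divr_gt0.
    by rewrite add0r; exists m.
  have near_n (n : 'I_m) : \forall psi \near chi,
      (circle_dist (dual_val (set_val chi) (g n)) (dual_val (set_val psi) (g n))
        < eps / 2)%R.
    have chi_n :
        (fun psi : set_type A => dual_val (set_val psi) (g n)) @ chi -->
        dual_val (set_val chi) (g n).
      exact: (cvg_comp (set_val : set_type A -> dual R G)
        (fun psi : dual R G => dual_val psi (g n))
        (@initial_continuous _ _ set_val chi) (@dual_eval_continuous _ _ _ _)).
    have half : (0 < eps / 2)%R by rewrite divr_gt0.
    exact: chi_n (circle_dist_near _ half).
  have near_all :=
    @filter_forall _ _ _ _ (nbhs_filter (chi : set_type A)) near_n.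
  apply: (@filterS _ _ (nbhs_filter (chi : set_type A)) _ _ _ near_all).
  move=> psi psi_n.
  have : (character_dist chi psi < eps)%R; last by rewrite ballEmdist.
  apply: (@le_lt_trans _ _ (eps / 2)%R); last by lra.
  apply: character_dist_le => n; have [nm|mn] := ltnP n m.
    rewrite /scaled_dist ler_pdivrMr// (le_trans (ltW (psi_n (Ordinal nm))))//.
    by apply: ler_peMr; [rewrite divr_ge0// ltW|rewrite ler1n].
  rewrite (le_trans (scaled_dist_le _ _ _))//.
  have inv_le : (n.+1%:R^-1 <= m.+1%:R^-1 :> R)%R.
    by rewrite lef_pV2 ?posrE// ler_nat.
  move: inv_le m_eps; set u := (n.+1%:R^-1)%R; set v := (m.+1%:R^-1)%R.
  by move=> inv_le m_eps; lra.
- apply: continuous_comp_initial => chi.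
  apply: (iffRL (@dual_cvgP R G _
    (fmap_filter _ (nbhs_filter (chi : M))) _)) => x.
  apply: (@circle_dist_cvg _ _ (fmap_filter _
    (nbhs_filter (chi : M)))) => eps eps0.
  have [n gn] := g_dense x.
  have eps_n : (0 < eps / n.+1%:R)%R by rewrite divr_gt0.
  have near_chi := nbhsx_ballx (chi : M) _ eps_n.
  apply: (@filterS _ _ (nbhs_filter (chi : M)) _ _ _ near_chi) => psi.
  rewrite ballEmdist /= => d_lt.
  rewrite !gn; [|exact: set_valP|exact: set_valP].
  have := le_lt_trans (scaled_dist_ub chi psi n) d_lt.
  by rewrite /scaled_dist ltr_pM2r ?invr_gt0.
Qed.

End countable_metrization.

(** * Finite sets of values *)

Section finiteness.

Lemma infinite_not_injective (T U : Type) (A : set T) (f : T -> U) :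
  infinite_set A -> finite_set (f @` A) ->
  exists a b, [/\ A a, A b, a <> b & f a = f b].
Proof.
move=> infA finf; apply: contrapT => inj_f; apply: infA.
have f_inj : {in A &, injective f}.
  move=> a b /[!inE] Aa Ab fab; apply: contrapT => ab.
  by apply: inj_f; exists a, b.
by rewrite -(eq_finite_set (inj_card_eq f_inj)).
Qed.

Lemma finite_joint_values (I : eqType) (T U : Type) (F : I -> T -> U)
    (s : seq I) :
  (forall i, i \in s -> finite_set (range (F i))) ->
  finite_set (range (fun x => [seq F i x | i <- s])).
Proof.
elim: s => [|i s IH] fin_s.
  by apply: sub_finite_set (finite_set1 [::]) => _ [x _ <-].
have fin_i : finite_set (range (F i)) by apply: fin_s; rewrite mem_head.
have fin_rest : finite_set (range (fun x => [seq F j x | j <- s])).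
  by apply: IH => j js; apply: fin_s; rewrite inE js orbT.
apply: sub_finite_set (finite_image2 cons fin_i fin_rest) => _ [x _ <-] /=.
by exists (F i x); [exists x|exists [seq F j x | j <- s]; [exists x|]].
Qed.

Lemma countably_infiniteP (T : Type) :
  countably_infinite T <-> countable [set: T] /\ infinite_set [set: T].
Proof. by rewrite /countably_infinite card_eqPle infiniteP. Qed.

Lemma near_all_mem (T : eqType) (I : Type) (F : set_system I) (FF : Filter F)
    (s : seq T) (P : T -> I -> Prop) :
  (forall x, \forall i \near F, P x i) ->
  \forall i \near F, forall x, x \in s -> P x i.
Proof.
move=> FP; elim: s => [|x s IH]; first exact: filterE.
apply: filterS (filterI (FP x) IH) => i [Px Ps] y.
by rewrite inE => /orP[/eqP ->|/Ps].
Qed.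

(** The points of A other than l form a closed set. *)
Lemma eventually_eq_finite (T : topologicalType) (u : nat -> T) (l : T)
    (A : set T) : hausdorff_space T -> finite_set A -> (forall n, A (u n)) ->
  u @ \oo --> l -> \forall n \near \oo, u n = l.
Proof.
move=> hT finA uA ul.
have finB : finite_set (A `\ l) by apply: sub_finite_set finA => x [].
have open_B : open (~` (A `\ l)).
  by apply: closed_openC; apply: compact_closed => //; exact: finite_compact.
have near_l : nbhs l (~` (A `\ l)).
  by apply: open_nbhs_nbhs; split => // -[_]; apply.
have near_n : \forall n \near \oo, (~` (A `\ l)) (u n) := ul _ near_l.
apply: filterS near_n => n nAl.
by apply: contrapT => unl; apply: nAl; split.
Qed.

End finiteness.

(** * The dual of a torsion group *)

Section dual_lemmas.
Local Open Scope group_scope.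
Variables (R : realType) (G : topologicalGroupType).
Implicit Types chi psi : dual R G.

Lemma dual_hausdorff : hausdorff_space (dual R G).
Proof.
move=> chi psi cp; apply: dual_val_inj; apply/funext => x.
apply: (@circle_hausdorff R) => A B Ax Bx.
have [xi [Axi Bxi]] := cp _ _ (@dual_eval_continuous R G x chi _ Ax)
  (@dual_eval_continuous R G x psi _ Bx).
by exists (dual_val xi x).
Qed.

Lemma dual_valX chi n x : dual_val (chi ^+ n) x = dual_val chi x ^+ n.
Proof. by elim: n => [//|n IH]; rewrite !expgS -IH. Qed.

Lemma dual_val1 chi : dual_val chi 1 = 1.
Proof. exact: homomorphism1 (dual_valP chi).2. Qed.

Lemma finite_evaluation (x : G) : torsion_group G ->
  finite_set (range (fun chi => dual_val chi x)).
Proof.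
move=> G_torsion; have [n n0 xn1] := G_torsion x.
apply: sub_finite_set (finite_circle_roots R n0) => _ [chi _ <-] /=.
by rewrite -(homomorphismX (dual_valP chi).2) xn1 dual_val1.
Qed.

(** The filter generated by the annihilators of finite sets converges pointwise,
    so it is finer than the neighbourhoods of the trivial character. *)
Lemma nbhs_dual1 (W : set (dual R G)) : nbhs (1 : dual R G) W ->
  exists s : seq G, forall chi,
    (forall x, x \in s -> dual_val chi x = 1) -> W chi.
Proof.
pose U (s : seq G) := [set chi : dual R G |
  forall x, x \in s -> dual_val chi x = 1].
have UF : Filter (filter_from [set: seq G] U).
  apply: filter_from_filter; first by exists [::].
  move=> s t _ _; exists (s ++ t) => // chi chi1.
  by split=> x xs; apply: chi1; rewrite mem_cat xs ?orbT.
have U1 : filter_from [set: seq G] U --> (1 : dual R G).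
  apply: (iffRL (@dual_cvgP R G _ UF 1)) => x V V1; exists [:: x] => // chi.
  by move=> /(_ x (mem_head _ _)) /= ->; exact: nbhs_singleton V1.
by move=> /U1[s _ sW]; exists s.
Qed.

End dual_lemmas.

(** * The implications *)

Section implications.
Local Open Scope group_scope.
Variables (R : realType) (G : topologicalGroupType).
Hypotheses (G_torsion : torsion_group G) (G_abelian : abelian_group G).

(** The subgroup is the group of the characters that are trivial on the kernel of
    f, that is, those which descend to H. *)
Lemma metrizable_subgroup_of_image (H : topologicalGroupType) (f : G -> H) :
    precompact_group G -> hausdorff_space H -> countably_infinite H ->
    continuous f -> homomorphism f -> range f = setT ->
  exists A : set (dual R G),
    [/\ subgroup A, infinite_set A & metrizable R (set_type A)].
Proof.
move=> G_precompact hH /countably_infiniteP[countH infH] cf fM f_onto.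
pose N : set G := [set x | f x = 1].
have N_subgroup : subgroup N.
  split=> [|x y Nx Ny|x Nx]; rewrite /N/=.
  - exact: homomorphism1.
  - by rewrite fM Nx Ny mulg1.
  - by rewrite (homomorphismV fM) Nx invg1.
have N_closed : closed N.
  by apply: closed_equalizer => //; exact: cst_continuous.
have N_eq x y : f x = f y -> N (x^-1 * y).
  by move=> fxy; rewrite /N/= fM (homomorphismV fM) fxy mulVg.
have /choice[sect sectK] : forall h, exists x, f x = h.
  move=> h; have [x _ fx] : range f h by rewrite f_onto.
  by exists x.
pose A : set (dual R G) := [set chi | forall y, N y -> dual_val chi y = 1].
have A_eq chi x y : A chi -> f x = f y -> dual_val chi x = dual_val chi y.
  move=> Achi /N_eq/Achi; have [_ chiM] := dual_valP chi.
  rewrite chiM (homomorphismV chiM) => /mulg1_eq; by rewrite invgK.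
exists A; split.
- split=> [//|chi psi Achi Apsi|chi Achi] y Ny /=.
  + rewrite -[LHS]/(dual_val chi y * dual_val psi y).
    by rewrite Achi// Apsi// mulg1.
  + by rewrite -[LHS]/((dual_val chi y)^-1) Achi// invg1.
- (* A finite group of characters has finite exponent, so its members take
     finitely many values and cannot separate the points of H. *)
  move=> /finite_seqP[l Al].
  have Ain chi : (chi \in l) <-> A chi by rewrite Al.
  have AX chi k : A chi -> A (chi ^+ k).
    by move=> Achi y Ny; rewrite dual_valX Achi// expg1n.
  have fin_range chi : chi \in l -> finite_set (range (dual_val chi)).
    move=> /Ain Achi.
    have fin_powers : finite_set ((fun k => chi ^+ k) @` [set: nat]).
      apply: sub_finite_set (finite_seq l) => _ [k _ <-] /=.
      by apply/Ain; exact: AX.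
    have [i [j [_ _ /eqP ij chi_ij]]] :=
      infinite_not_injective infinite_nat fin_powers.
    wlog lt_ij : i j ij chi_ij / (i < j)%N.
      by move=> W; move: (ij); rewrite neq_ltn => /orP[|] h;
        [exact: (W i j)|apply: (W j i) => //; rewrite eq_sym].
    apply: (@sub_finite_set _ _ [set z : circle R | z ^+ (j - i) = 1]).
      move=> _ [x _ <-] /=; rewrite expgnFr ?(ltnW lt_ij)//.
      by rewrite -!dual_valX chi_ij mulgV.
    by apply: finite_circle_roots; rewrite subn_gt0.
  have fin_values := finite_joint_values fin_range.
  have [//|h [h' [_ _ hh' val_eq]]] := infinite_not_injective
    (f := fun h => [seq dual_val chi (sect h) | chi <- l]) infH _.
    by apply: sub_finite_set fin_values => _ [h _ <-]; exists (sect h).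
  have nN : ~ N ((sect h)^-1 * sect h').
    rewrite /N/= fM (homomorphismV fM) !sectK => /mulg1_eq; rewrite invgK.
    exact: hh'.
  have [chi [Achi []]] := characters_separate_closed_subgroup R
    G_precompact G_torsion G_abelian N_subgroup N_closed nN.
  have [_ chiM] := dual_valP chi; rewrite chiM (homomorphismV chiM).
  have /Ain chil : A chi by [].
  have /eq_in_map/(_ _ chil) -> := val_eq.
  by rewrite mulVg.
- have [i i_inj] := countable_injP _ countH.
  have /choice[g gP] : forall n, exists x, forall h, i h = n -> f x = h.
    move=> n; have [[h hn]|nh] := pselect (exists h, i h = n).
      exists (sect h) => h' h'n; rewrite sectK; apply: i_inj; rewrite ?inE//.
      by rewrite hn h'n.
    by exists 1 => h hn; case: nh; exists h.
  apply: (@metrizable_character_set R G A g) => x.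
  exists (i (f x)) => chi Achi; apply: A_eq => //.
  by apply/esym/gP.
Qed.

(** The trivial character is not isolated in A, because the elements of A have
    only finitely many restrictions to a given finite set of points. *)
Lemma convergent_sequence_of_metrizable (A : set (dual R G)) :
    subgroup A -> infinite_set A -> metrizable R (set_type A) ->
  exists u : nat -> dual R G, nontrivial_convergent_sequence u.
Proof.
move=> [A1 AM AV] infA [M [f [g [fK gK cf cg]]]].
have accum (W : set (dual R G)) : nbhs (1 : dual R G) W ->
    exists a, [/\ A a, a <> 1 & W a].
  move=> /nbhs_dual1[s sW].
  have fin_values : finite_set
      ((fun chi => [seq dual_val chi x | x <- s]) @` A).
    have fin := @finite_joint_values _ _ _ (fun x chi => dual_val chi x) s
      (fun x _ => finite_evaluation R x G_torsion).
    by apply: sub_finite_set fin => _ [chi _ <-]; exists chi.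
  have [a [b [Aa Ab ab val_eq]]] := infinite_not_injective infA fin_values.
  exists (a^-1 * b); split.
  - by apply: AM => //; exact: AV.
  - by move=> /mulg1_eq; rewrite invgK.
  - apply: sW => x xs; rewrite -[LHS]/((dual_val a x)^-1 * dual_val b x).
    by have /eq_in_map/(_ _ xs) -> := val_eq; rewrite mulVg.
pose one : set_type A := exist _ (1 : dual R G) (mem_set A1).
have /choice[v vP] : forall n, exists a : set_type A,
    set_val a <> 1 /\ ball (f one) (n.+1%:R^-1)%R (f a).
  move=> n.
  have inv_gt0 : (0 < n.+1%:R^-1 :> R)%R by rewrite invr_gt0.
  have [/= V [[W oW <-] /= W1 WV]] := cf one _ (nbhsx_ballx (f one) _ inv_gt0).
  have [a [Aa a1 Wa]] := accum W (open_nbhs_nbhs (conj oW W1)).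
  by exists (exist _ a (mem_set Aa)); split => //; exact: WV.
have fv : (f \o v) @ \oo --> f one.
  apply/cvg_ballP => eps eps0.
  have := near_infty_natSinv_lt (PosNum eps0).
  apply: filterS => n n_eps; have [_] := vP n.
  exact: le_ball (ltW n_eps) _.
have u_cvg : (set_val \o v : nat -> dual R G) @ \oo --> (1 : dual R G).
  have v_cvg : v @ \oo --> one.
    have := cvg_comp _ _ fv (cg (f one)).
    rewrite fK; apply: cvg_trans; apply: near_eq_cvg; near=> n.
    by rewrite /= fK.
  exact: cvg_comp v_cvg (@initial_continuous _ _ set_val one).
exists (set_val \o v); split; first by exists 1.
move=> [c near_c].
have c1 : c = 1.
  apply: (cvg_unique (@dual_hausdorff R G)) u_cvg.
  exact: cvg_near_cst near_c.
have [n vn] := filter_ex near_c.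
by have [] := vP n; rewrite -c1.
Unshelve. all: by end_near. Qed.

(** N is the common kernel of the translated sequence: each of its cosets is
    determined by finitely many torsion points of the circle, and no finite set
    of cosets can exhaust G, for otherwise the sequence would be eventually
    constant. *)
Lemma quotient_of_convergent_sequence (u : nat -> dual R G) :
    nontrivial_convergent_sequence u ->
  exists N : normal_subgroup G,
    closed (N : set G) /\ countably_infinite (quotient_group N).
Proof.
move=> [[l ul] not_const].
pose chi n := l^-1 * u n.
have chi_cvg : chi @ \oo --> (1 : dual R G).
  by rewrite -(mulVg l); apply: mulg_cvg => //; exact: cvg_cst.
have chiM n : homomorphism (dual_val (chi n)) by have [] := dual_valP (chi n).
have chi_torsion n x : exists2 m, (0 < m)%N & dual_val (chi n) x ^+ m = 1.
  have [m m0 xm1] := G_torsion x; exists m => //.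
  by rewrite -(homomorphismX (chiM n)) xm1 dual_val1.
have near1 x : \forall n \near \oo, dual_val (chi n) x = 1.
  apply: (@eventually_eq_finite _ _ _ _ (@circle_hausdorff R)
    (finite_evaluation R x G_torsion)); first by move=> n; exists (chi n).
  exact: cvg_comp chi_cvg (@dual_eval_continuous R G x 1).
pose K : set G := [set x | forall n, dual_val (chi n) x = 1].
have K_subgroup : subgroup K.
  split=> [n|x y Kx Ky n|x Kx n]; first exact: dual_val1.
  - by rewrite chiM Kx Ky mulg1.
  - by rewrite (homomorphismV (chiM n)) Kx invg1.
have K_normal x y : K x -> K (y^-1 * x * y).
  by rewrite -mulgA (G_abelian x) mulKg.
pose N := NormalSubgroup K_subgroup K_normal.
have K_eq x y : (forall n, dual_val (chi n) x = dual_val (chi n) y) ->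
    K (x^-1 * y).
  by move=> xy n; rewrite chiM (homomorphismV (chiM n)) xy mulVg.
exists N; split.
  have -> : (N : set G) = \bigcap_n [set x | dual_val (chi n) x = 1].
    by apply/seteqP; split=> x Kx n; [move=> _; exact: Kx|exact: Kx n I].
  apply: closed_bigI => n _; apply: closed_equalizer => //.
  - exact: circle_hausdorff.
  - by have [] := dual_valP (chi n).
  - exact: cst_continuous.
apply/countably_infiniteP; split.
  have [i i_inj] := countable_injP _ (countable_circle_torsion R).
  have /choice[m mP] : forall x, exists m, forall n, (m <= n)%N ->
      dual_val (chi n) x = 1.
    by move=> x; have [m _ mx] := near1 x; exists m => n mn; exact: mx.
  pose code q := let x := @quotient_repr G N q in
    [seq i (dual_val (chi n) x) | n <- iota 0 (m x)].
  have code_inj : injective code.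
    move=> q r qr; rewrite -(quotient_reprK q) -(quotient_reprK r).
    apply: quotient_projE; apply: K_eq => n.
    set x := quotient_repr q; set y := quotient_repr r.
    have mxy : m x = m y.
      by have /(congr1 size) := qr; rewrite /code !size_map !size_iota.
    have [mn|nm] := leqP (m x) n; first by rewrite !mP// -mxy.
    apply: i_inj; rewrite ?inE; [exact: chi_torsion|exact: chi_torsion|].
    move: qr; rewrite /code -/x -/y -mxy => /eq_in_map; apply.
    by rewrite mem_iota.
  apply/countable_injP; exists (pickle \o code) => q r _ _ /=.
  by move=> /(pcan_inj pickleK)/code_inj.
move=> /finite_seqP[s sP]; apply: not_const; exists l.
have near_s := @near_all_mem _ _ _ (@eventually_filter) s _
  (fun q : quotient_group N => near1 (quotient_repr q)).
apply: filterS near_s => n chi_s.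
have chi1 : chi n = 1.
  apply: dual_val_inj; apply/funext => x.
  have /chi_s : quotient_proj N x \in s.
    by have : [set: quotient_group N] (quotient_proj N x) by []; rewrite sP.
  have /quotient_projP := quotient_reprK (quotient_proj N x).
  move=> /(_ n); rewrite chiM (homomorphismV (chiM n)) => /[swap] ->.
  by rewrite invg1 mul1g.
by have := congr1 (fun c => l * c) chi1; rewrite /chi mulVKg mulg1.
Qed.

End implications.

Theorem theorem2p7 (R : realType) (G : topologicalGroupType)
    (G_precompact : precompact_group G) (G_torsion : torsion_group G)
    (G_abelian : abelian_group G) :
  all_iff
    (exists N : normal_subgroup G,
       closed (N : set G) /\ countably_infinite (quotient_group N))
    [:: exists (H : topologicalGroupType) (f : G -> H),
          [/\ hausdorff_space H, countably_infinite H, continuous f,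
              homomorphism f & range f = setT];
        exists A : set (dual R G),
          [/\ subgroup A, infinite_set A & metrizable R (set_type A)];
        exists u : nat -> dual R G, nontrivial_convergent_sequence u].
Proof.
split=> [[N [cN N_infinite]]|].
  exists (quotient_group N), (quotient_proj N); split=> //.
  - exact: quotient_hausdorff.
  - exact: quotient_proj_continuous.
  - exact: quotient_projM.
  - apply/seteqP; split=> // q _; exists (quotient_repr q) => //.
    exact: quotient_reprK.
split=> [[H [f [hH countH cf fM f_onto]]]|].
  exact: metrizable_subgroup_of_image hH countH cf fM f_onto.
split=> [[A [A_subgroup infA metA]]|[u u_cvg]].
  exact: convergent_sequence_of_metrizable A_subgroup infA metA.
exact: quotient_of_convergent_sequence u_cvg.
Qed.
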